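(* For each integer $n\ge 2$ let $X_1=X_1^{(n)},\dots,X_n=X_n^{(n)}$ be independent real random variables with distribution functions $F_{n,1},\dots,F_{n,n}$, such that $\bar F_n=n^{-1}\sum_{i=1}^n F_{n,i}$ is continuous. Suppose that for every $n\ge 2$ there is a partition $\mathcal I_{n,1},\dots,\mathcal I_{n,g}$ (with $g=g(n)$) of $\{1,\dots,n\}$ such that each $\mathcal I_{n,j}$ contains at least 2 indices and $F_{n,i}=F_{n,i'}$ for all $i,i'\in\mathcal I_{n,j}$. Then for every $\tau\in(0,1)$ such that $nV_n(\tau)=\sum_{i=1}^n F_{n,i}(\bar Q_n(\tau))[1-F_{n,i}(\bar Q_n(\tau))]\to\infty$ as $n\to\infty$, $$\widehat V(\tau)/V_n(\tau)\xrightarrow{p}1\qquad (n\to\infty),$$ where $\xrightarrow{p}$ denotes convergence in probability.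
   Context: The quantile function of a distribution function $F$ is its left-continuous inverse $p\mapsto\inf\{x\in\mathbb R: F(x)\ge p\}$. $\bar Q_n$ denotes the quantile function of $\bar F_n$. The empirical distribution function is $\widehat F(x)=n^{-1}\sum_{i=1}^n \mathbf 1\{X_i\le x\}$, and $\widehat Q$ denotes its quantile function (the empirical quantile function). The heterogeneous variance is $V_n(\tau)=n^{-1}\sum_{i=1}^n F_{n,i}(\bar Q_n(\tau))[1-F_{n,i}(\bar Q_n(\tau))]$. With $m_j$ the cardinality of $\mathcal I_{n,j}$ (so $n=m_1+\cdots+m_g$), the variance estimator is $$\widehat V(\tau)=n^{-1}\sum_{j=1}^{g}\frac{1}{m_j-1}\sum_{\ell_1,\ell_2\in\mathcal I_{n,j}}\mathbf 1\{X_{\ell_1}\le\widehat Q(\tau),\,X_{\ell_2}>\widehat Q(\tau)\}.$$ The partition, $g$ and $m_j$ may all depend on $n$. *)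

(* Defs.v *)
From HB Require Import structures.
From mathcomp Require Import all_boot all_order all_algebra.
From mathcomp Require Import all_classical all_reals all_analysis.

Set Implicit Arguments.
Unset Strict Implicit.
Unset Printing Implicit Defensive.

Import Order.TTheory GRing.Theory Num.Theory.
Import numFieldNormedType.Exports.

Local Open Scope classical_set_scope.
Local Open Scope ring_scope.

(* Mutual independence of a finite family: the product rule for every
   subfamily and all Borel sets. *)
Definition independent_RVs d (T : measurableType d) (R : realType)
    (P : probability T R) (I : finType) (X : I -> {RV P >-> R}) : Prop :=
  forall (J : {set I}) (B : I -> set R),
    (forall i, i \in J -> measurable (B i)) ->
    P [set w | forall i, i \in J -> B i (X i w)] =
    (\prod_(i in J) P (X i @^-1` B i))%E.

(* The sample space may change with [n], as for a triangular array. The events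
   below are assigned their probability only when [Y n] is measurable, as is
   the case for statistics such as [variance_estimator]. *)
Definition cvg_in_probability (R : realType) (d : nat -> measure_display)
    (T : forall n, measurableType (d n)) (P : forall n, probability (T n) R)
    (Y : forall n, T n -> R) (l : R) : Prop :=
  forall eps : R, 0 < eps ->
    P n [set w | eps < `|Y n w - l|] @[n --> \oo] --> 0%E.

(* [inf] is a total function with [inf set0 = 0]; for a distribution function
   [F] and [0 < p < 1] the set below is nonempty and bounded from below. *)
Definition quantile (R : realType) (F : R -> R) (p : R) : R :=
  inf [set x | p <= F x].

Definition average_df (R : realType) (n : nat) (F : 'I_n -> R -> R) (x : R)
  : R := n%:R^-1 * \sum_(i < n) F i x.

Definition empirical_df (R : realType) (n : nat) (x : 'I_n -> R) (y : R) : R :=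
  n%:R^-1 * \sum_(i < n) (x i <= y)%R%:R.

Definition heterogeneous_variance (R : realType) (n : nat)
    (F : 'I_n -> R -> R) (tau : R) : R :=
  let q := quantile (average_df F) tau in
  n%:R^-1 * \sum_(i < n) F i q * (1 - F i q).

(* [x] is the observed sample and [Pi] the set of blocks of the partition. *)
Definition variance_estimator (R : realType) (n : nat) (Pi : {set {set 'I_n}})
    (x : 'I_n -> R) (tau : R) : R :=
  let q := quantile (empirical_df x) tau in
  n%:R^-1 * \sum_(A in Pi) (#|A|%:R - 1)^-1 *
    \sum_(l1 in A) \sum_(l2 in A) ((x l1 <= q) && (q < x l2))%R%:R.

(* Main.v *)
Require Import Defs.
From HB Require Import structures.
From mathcomp Require Import all_boot all_order all_algebra.
From mathcomp Require Import all_classical all_reals all_analysis.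
From mathcomp Require Import measurable_realfun ring lra zify.

(** Write q for the tau-quantile of the average distribution function and
    v = n V for the sum of F_i(q)(1 - F_i(q)), which tends to infinity.  For a
    threshold y let S_y be the random set of the indices i with X_i <= y; the
    empirical distribution function at y is #|S_y| / n, and the variance
    estimator with the empirical quantile replaced by y is h(S_y) / n for an
    explicit function h of finite sets, [block_stat].

    Two facts about h carry the proof.  First, its mean at a fixed y is exactly
    the sum of F_i(y)(1 - F_i(y)), because the distribution function is constant
    on each block ([bern_mean_block_stat]).  Second, h varies by at most
    #|S'| - #|S| between nested sets S and S' ([block_stat_lipschitz]): on a
    block of size m it is k(m - k)/(m - 1), whose increments in k lie in [-1, 1].

    The second fact is used twice.  Adding one point to S changes h(S), and of
    course #|S|, by at most 1; by the Efron-Stein inequality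
    ([bern_var_lipschitz]) the variances of h(S_y) and of #|S_y| are then at
    most the sum of F_i(y)(1 - F_i(y)), so that Chebyshev's inequality places
    both within a small multiple of v of their means, with a probability of
    failure of order 1/v.  Moreover the sets S_y are nested in y, so replacing q
    by the empirical quantile Q costs at most the absolute difference of #|S_Q|
    and #|S_q|.

    It remains to see that this difference is small compared with v.  If Q <= q
    then n tau <= #|S_Q| <= #|S_q|, and #|S_q| concentrates around n tau.  If
    Q > q, a bound on #|S_Q| from above is needed; ties in the sample prevent a
    direct comparison with n tau.  Instead choose q' >= q at which the average
    distribution function equals tau + delta v / n, which continuity permits.
    Since #|S_q'| concentrates around n tau + delta v, with high probability it
    exceeds n tau, so that Q <= q', and then #|S_Q| <= #|S_q'| is at most
    n tau + 2 delta v ([block_stat_quantile_near]).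

    Only the joint law of finitely many indicators of X_i <= y enters, so means
    and variances are finite sums over sets of indices weighted by products of
    the F_i(y) and 1 - F_i(y) ([sublevel_law]). *)

Set Implicit Arguments.
Unset Strict Implicit.
Unset Printing Implicit Defensive.

Import Order.TTheory GRing.Theory Num.Theory.
Import numFieldNormedType.Exports.

Local Open Scope classical_set_scope.
Local Open Scope ring_scope.

(** * Random subsets with independent memberships *)

Definition bern_weight (R : numDomainType) (I : finType) (p : I -> R)
    (A S : {set I}) : R :=
  \prod_(i in A) (if i \in S then p i else 1 - p i).

(** The expectation of f(S), where S is the random subset of A that contains
    each i in A with probability p i, independently. *)
Definition bern_mean (R : numDomainType) (I : finType) (p : I -> R)
    (A : {set I}) (f : {set I} -> R) : R :=
  \sum_(S : {set I} | S \subset A) bern_weight p A S * f S.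

Lemma bern_mean_set0 (R : numDomainType) (I : finType) (p : I -> R)
    (f : {set I} -> R) :
  bern_mean p finset.set0 f = f finset.set0.
Proof.
rewrite /bern_mean (big_pred1 finset.set0) => [|S]; last by rewrite finset.subset0.
by rewrite /bern_weight big_set0 mul1r.
Qed.

(** Conditioning on whether i belongs to the random set: every computation of
    a mean below removes points one at a time in this way. *)
Lemma bern_mean_setU1 (R : numDomainType) (I : finType) (p : I -> R) (i : I)
    (A : {set I}) (f : {set I} -> R) : i \notin A ->
  bern_mean p (i |: A) f =
  p i * bern_mean p A (fun S => f (i |: S)) + (1 - p i) * bern_mean p A f.
Proof.
move=> iA; rewrite /bern_mean (bigID (fun S : {set I} => i \in S)) /=.
have sub1 (S : {set I}) : S \subset A -> i \notin S.
  by move=> /fintype.subsetP SA; apply: contra iA; exact: SA.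
congr (_ + _).
- rewrite mulr_sumr.
  rewrite (reindex_onto (fun S : {set I} => i |: S) (fun S => S :\ i)) /=; last first.
    by move=> S /andP[_ iS]; rewrite finset.setD1K.
  apply: eq_big => [S|S /andP[/andP[_ _] /eqP eS]].
    apply/andP/idP => [[/andP[sub _] /eqP <-]|SA].
      by rewrite finset.subDset.
    by rewrite finset.setUS // setU11 setU1K // sub1.
  rewrite mulrA /bern_weight big_setU1 //= setU11; congr (_ * _ * _).
  apply: eq_bigr => j jA; rewrite !finset.inE.
  by case: eqP => // ji; rewrite -ji jA in iA.
- rewrite mulr_sumr; apply: eq_big => [S|S /andP[_ iS]].
    apply/andP/idP => [[sub iS]|SA].
      by rewrite -(setU1K iA) finset.subsetD1 sub.
    by rewrite sub1 // (fintype.subset_trans SA) // finset.subsetUr.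
  by rewrite mulrA /bern_weight big_setU1 //= (negbTE iS).
Qed.

Lemma bern_mean_sum (R : numDomainType) (I J : finType) (p : I -> R)
    (A : {set I}) (Q : pred J) (f : J -> {set I} -> R) :
  bern_mean p A (fun S => \sum_(j | Q j) f j S) =
  \sum_(j | Q j) bern_mean p A (f j).
Proof.
rewrite /bern_mean exchange_big /=; apply: eq_bigr => S _.
by rewrite mulr_sumr.
Qed.

Lemma bern_meanZ (R : numDomainType) (I : finType) (p : I -> R)
    (A : {set I}) (c : R) (f : {set I} -> R) :
  bern_mean p A (fun S => c * f S) = c * bern_mean p A f.
Proof.
by rewrite /bern_mean mulr_sumr; apply: eq_bigr => S _; rewrite mulrCA.
Qed.

Lemma bern_meanB (R : numDomainType) (I : finType) (p : I -> R)
    (A : {set I}) (f g : {set I} -> R) :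
  bern_mean p A (fun S => f S - g S) = bern_mean p A f - bern_mean p A g.
Proof.
by rewrite /bern_mean -sumrB; apply: eq_bigr => S _; rewrite mulrBr.
Qed.

Lemma bern_mean_eq (R : numDomainType) (I : finType) (p : I -> R)
    (A : {set I}) (f g : {set I} -> R) :
  (forall S : {set I}, S \subset A -> f S = g S) -> bern_mean p A f = bern_mean p A g.
Proof. by move=> fg; apply: eq_bigr => S SA; rewrite fg. Qed.

Lemma bern_mean_cst (R : numDomainType) (I : finType) (p : I -> R)
    (A : {set I}) (c : R) : bern_mean p A (fun=> c) = c.
Proof.
suff H n (B : {set I}) : #|B| = n -> bern_mean p B (fun=> c) = c by exact: H.
elim: n B => [|n IH] B cB.
  by rewrite (cards0_eq cB) bern_mean_set0.
have /card_gt0P[i iB] : (0 < #|B|)%N by rewrite cB.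
rewrite -(finset.setD1K iB) bern_mean_setU1 ?finset.setD11 // IH; first by ring.
by move: cB; rewrite (cardsD1 i) iB => -[].
Qed.

Lemma bern_weight_ge0 (R : numDomainType) (I : finType) (p : I -> R)
    (A S : {set I}) : (forall i, 0 <= p i <= 1) -> 0 <= bern_weight p A S.
Proof.
move=> p01; apply: prodr_ge0 => i _; have /andP[p0 p1] := p01 i.
by case: ifP => _ //; rewrite subr_ge0.
Qed.

Lemma bern_mean_le (R : numDomainType) (I : finType) (p : I -> R)
    (A : {set I}) (f g : {set I} -> R) : (forall i, 0 <= p i <= 1) ->
  (forall S, f S <= g S) -> bern_mean p A f <= bern_mean p A g.
Proof.
move=> p01 fg; apply: ler_sum => S _.
by apply: ler_wpM2l => //; exact: bern_weight_ge0.
Qed.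

(** The Efron-Stein inequality for a function that changes by at most 1 when a
    point is added.  By induction on A: conditioning on the membership of a
    point i splits the variance into the average of the two conditional
    variances, and p i (1 - p i) times the squared gap between the two
    conditional means; this gap is at most 1. *)
Lemma bern_var_lipschitz (R : realFieldType) (I : finType) (p : I -> R)
    (A : {set I}) (f : {set I} -> R) : (forall i, 0 <= p i <= 1) ->
  (forall i (S : {set I}), i \notin S -> `|f (i |: S) - f S| <= 1) ->
  bern_mean p A (fun S => f S ^+ 2) - bern_mean p A f ^+ 2 <=
  \sum_(i in A) p i * (1 - p i).
Proof.
move=> p01.
suff H n (B : {set I}) g : #|B| = n ->
    (forall i (S : {set I}), i \in B -> i \notin S -> `|g (i |: S) - g S| <= 1) ->
    bern_mean p B (fun S => g S ^+ 2) - bern_mean p B g ^+ 2 <=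
    \sum_(i in B) p i * (1 - p i).
  by move=> f1; apply: (H _ _ _ erefl) => i S _; exact: f1.
elim: n B g => [|n IH] B g cB g1.
  by rewrite (cards0_eq cB) !bern_mean_set0 big_set0 subrr.
have /card_gt0P[i iB] : (0 < #|B|)%N by rewrite cB.
have cBi : #|B :\ i| = n by move: cB; rewrite (cardsD1 i) iB => -[].
have iBi : i \notin B :\ i by rewrite finset.setD11.
rewrite -(finset.setD1K iB) big_setU1 //= !bern_mean_setU1 //.
set C := B :\ i in cBi iBi *.
have CB j : j \in C -> j \in B by move=> /finset.setD1P[].
have /= V1 := IH C (fun S => g (i |: S)) cBi.
have /= V0 := IH C g cBi.
have {}V0 := V0 (fun j S jC jS => g1 j S (CB j jC) jS).
have {V1} V1 : bern_mean p C (fun S => g (i |: S) ^+ 2) -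
    bern_mean p C (fun S => g (i |: S)) ^+ 2 <= \sum_(i in C) p i * (1 - p i).
  apply: V1 => j S jC jS; rewrite finset.setUCA; apply: g1; first exact: CB.
  rewrite !finset.inE negb_or jS andbT.
  by apply: contraNneq iBi => <-.
have gap : `|bern_mean p C (fun S => g (i |: S)) - bern_mean p C g| <= 1.
  rewrite -bern_meanB.
  have E : bern_mean p C (fun S => g (i |: S) - g S) =
           bern_mean p C (fun S => g (i |: (S :\ i)) - g (S :\ i)).
    apply: bern_mean_eq => S SC; have -> : S :\ i = S => //.
    apply/eqP; rewrite finset.eqEsubset finset.subsetDl finset.subsetD1 fintype.subxx /=.
    by apply: contra iBi; apply/fintype.subsetP.
  rewrite E; apply/ler_normlP; split.
    rewrite -mulN1r -bern_meanZ -[leRHS](bern_mean_cst p C).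
    apply: bern_mean_le => // S; rewrite mulN1r.
    by have /ler_normlP[] := g1 i (S :\ i) iB (negbT (finset.setD11 i S)).
  rewrite -[leRHS](bern_mean_cst p C); apply: bern_mean_le => // S.
  by have /ler_normlP[] := g1 i (S :\ i) iB (negbT (finset.setD11 i S)).
have /andP[p0 p1] := p01 i.
have {gap} gap : (bern_mean p C (fun S => g (i |: S)) - bern_mean p C g) ^+ 2 <= 1.
  by rewrite -real_normK ?num_real // expr_le1.
move: gap V1 V0.
set a := bern_mean p C (fun S => g (i |: S)); set b := bern_mean p C g.
set a2 := bern_mean p C _; set b2 := bern_mean p C (fun S => g S ^+ 2).
set s := \sum_(j in C) _ => gap V1 V0.
have q0 : 0 <= 1 - p i by rewrite subr_ge0.
(* the conditional variances given that i does or does not belong to S, and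
   the variance of the conditional mean *)
have H1 : 0 <= p i * (s - (a2 - a ^+ 2)) by rewrite mulr_ge0 // subr_ge0.
have H0 : 0 <= (1 - p i) * (s - (b2 - b ^+ 2)) by rewrite mulr_ge0 // subr_ge0.
have H2 : 0 <= p i * (1 - p i) * (1 - (a - b) ^+ 2).
  by rewrite !mulr_ge0 // subr_ge0.
nra.
Qed.

(** * The within-block variance statistic of a set *)

(** The variance estimator, up to its factor 1/n, as a function of the set S of
    the observations that do not exceed the threshold. *)
Definition block_stat (R : numFieldType) (I : finType) (Q : {set {set I}})
    (S : {set I}) : R :=
  \sum_(A in Q) (#|A|%:R - 1)^-1 *
    \sum_(l1 in A) \sum_(l2 in A) ((l1 \in S) && (l2 \notin S))%:R.

Lemma sum_mem_card (R : pzSemiRingType) (I : finType) (A S : {set I}) :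
  \sum_(i in A) (i \in S)%:R = #|A :&: S|%:R :> R.
Proof.
rewrite -natr_sum -sum1_card [in RHS]big_mkcond [in LHS]big_mkcond /=.
by congr (_%:R); apply: eq_bigr => i _; rewrite finset.inE; do 2 case: (_ \in _).
Qed.

Lemma sum_pairs_card (R : pzRingType) (I : finType) (A S : {set I}) :
  \sum_(l1 in A) \sum_(l2 in A) ((l1 \in S) && (l2 \notin S))%:R =
  #|A :&: S|%:R * (#|A|%:R - #|A :&: S|%:R) :> R.
Proof.
under eq_bigr do under eq_bigr do rewrite -mulnb natrM.
rewrite -big_distrlr /= sum_mem_card; congr (_ * _).
rewrite (eq_bigr (fun l => 1 - (l \in S)%:R)); last first.
  by move=> l _; case: (l \in S); rewrite ?subrr ?subr0.
by rewrite sumrB sum_mem_card sumr_const.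
Qed.

(** Turns a sum of bounds over the blocks into one bound on the whole index
    set. *)
Lemma sum_partition_card (R : pzSemiRingType) (I : finType) (Q : {set {set I}})
    (S : {set I}) : finset.partition Q [set: I]%SET ->
  \sum_(A in Q) #|A :&: S|%:R = #|S|%:R :> R.
Proof.
move=> /and3P[/eqP cQ tQ _].
rewrite -[in RHS](finset.setTI S) -sum_mem_card -cQ finset.big_trivIset //=.
by apply: eq_bigr => A _; rewrite sum_mem_card.
Qed.

(** On a block of size m >= 2 that meets S in k points and S' in k' > k points,
    the difference is (k' - k)(m - k - k')/(m - 1), and 1 <= k + k' <= 2m - 1
    bounds the middle factor by m - 1. *)
Lemma block_stat_lipschitz (R : realFieldType) (I : finType)
    (Q : {set {set I}}) (S S' : {set I}) :
  finset.partition Q [set: I]%SET ->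
  (forall A, A \in Q -> (2 <= #|A|)%N) -> S \subset S' ->
  `|block_stat R Q S' - block_stat R Q S| <= #|S'|%:R - #|S|%:R.
Proof.
move=> partQ cardQ SS'.
rewrite -!(sum_partition_card _ _ partQ) -!sumrB.
apply: (le_trans (ler_norm_sum _ _ _)); apply: ler_sum => A AQ.
rewrite !sum_pairs_card -mulrBr normrM.
have m2 := cardQ _ AQ.
have k1 : (#|A :&: S| <= #|A :&: S'|)%N.
  by apply: subset_leq_card; exact: finset.setIS.
have k2 : (#|A :&: S'| <= #|A|)%N by apply: subset_leq_card; exact: finset.subsetIl.
move: k1 k2 m2; move: #|A :&: S| #|A :&: S'| #|A| => k k' m k1 k2 m2.
have m1 : 0 < m%:R - 1 :> R by rewrite subr_gt0 ltr1n.
rewrite ger0_norm ?invr_ge0 ?(ltW m1) // mulrC ler_pdivrMr //.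
have -> : k'%:R * (m%:R - k'%:R) - k%:R * (m%:R - k%:R) =
  (k'%:R - k%:R) * (m%:R - k%:R - k'%:R) :> R by ring.
have d0 : 0 <= k'%:R - k%:R :> R by rewrite subr_ge0 ler_nat.
rewrite normrM (ger0_norm d0).
move: k1; rewrite leq_eqVlt => /predU1P[->|k1]; first by rewrite subrr !mul0r.
apply: ler_wpM2l => //; apply/ler_normlP; split.
  have : (k + k' + 1 <= m + m)%N by lia.
  by rewrite -(ler_nat R) !natrD; lra.
have : (1 <= k + k')%N by lia.
by rewrite -(ler_nat R) !natrD; lra.
Qed.

Lemma bern_mean_mem_notin (R : numDomainType) (I : finType) (p : I -> R)
    (A : {set I}) (a b : I) : a \in A -> b \in A -> a != b ->
  bern_mean p A (fun S => ((a \in S) && (b \notin S))%:R) = p a * (1 - p b).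
Proof.
move=> aA bA ab.
have bAa : b \in A :\ a by rewrite !finset.inE eq_sym ab.
have aD : a \notin (A :\ a) :\ b by rewrite !finset.inE eqxx andbF.
rewrite -(finset.setD1K aA) bern_mean_setU1 ?finset.setD11 //.
rewrite [X in _ + _ * X](@bern_mean_eq _ _ _ _ _ (fun=> 0)); last first.
  by move=> S /finset.subsetD1P[_ aS]; rewrite (negbTE aS).
rewrite bern_mean_cst mulr0 addr0; congr (_ * _).
rewrite -(finset.setD1K bAa) bern_mean_setU1 ?finset.setD11 //.
rewrite [X in _ * X + _](@bern_mean_eq _ _ _ _ _ (fun=> 0)); last first.
  by move=> S _; rewrite !finset.inE !eqxx /= ?orbT ?andbF.
rewrite [X in _ + _ * X](@bern_mean_eq _ _ _ _ _ (fun=> 1)); last first.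
  move=> S /finset.subsetD1P[_ bS].
  by rewrite !finset.inE !eqxx eq_sym (negbTE ab) (negbTE bS).
by rewrite !bern_mean_cst mulr0 add0r mulr1.
Qed.

Lemma bern_mean_mem (R : numDomainType) (I : finType) (p : I -> R)
    (A : {set I}) (a : I) : a \in A ->
  bern_mean p A (fun S => (a \in S)%:R) = p a.
Proof.
move=> aA; rewrite -(finset.setD1K aA) bern_mean_setU1 ?finset.setD11 //.
rewrite [X in _ * X + _](@bern_mean_eq _ _ _ _ _ (fun=> 1)); last first.
  by move=> S _; rewrite setU11.
rewrite [X in _ + _ * X](@bern_mean_eq _ _ _ _ _ (fun=> 0)); last first.
  by move=> S /finset.subsetD1P[_ aS]; rewrite (negbTE aS).
by rewrite !bern_mean_cst mulr0 addr0 mulr1.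
Qed.

Lemma bern_mean_card (R : numDomainType) (I : finType) (p : I -> R) :
  bern_mean p [set: I]%SET (fun S => #|S|%:R) = \sum_i p i.
Proof.
rewrite (@bern_mean_eq _ _ _ _ _ (fun S => \sum_i (i \in S)%:R)); last first.
  move=> S _; rewrite -[in LHS](finset.setTI S) -sum_mem_card.
  by apply: eq_bigl => i; rewrite finset.in_setT.
by rewrite bern_mean_sum; apply: eq_bigr => i _; rewrite bern_mean_mem.
Qed.

(** The normalisation by m - 1 makes the statistic unbiased: in a block with
    common value p there are m(m - 1) ordered pairs of distinct points, each
    contributing p(1 - p), while pairs of equal points contribute nothing. *)
Lemma bern_mean_block_stat (R : numFieldType) (I : finType) (p : I -> R)
    (Q : {set {set I}}) : finset.partition Q [set: I]%SET ->
  (forall A, A \in Q -> (2 <= #|A|)%N) ->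
  (forall A, A \in Q -> {in A &, forall i j, p i = p j}) ->
  bern_mean p [set: I]%SET (block_stat R Q) = \sum_i p i * (1 - p i).
Proof.
move=> /and3P[/eqP cQ tQ _] cardQ homQ.
rewrite bern_mean_sum.
rewrite [RHS](eq_bigl (fun i => i \in [set: I]%SET)); last first.
  by move=> i; rewrite finset.in_setT.
rewrite -cQ finset.big_trivIset //=; apply: eq_bigr => A AQ.
have m1 : #|A|%:R - 1 != 0 :> R by rewrite subr_eq0 pnatr_eq1 gtn_eqF // cardQ.
rewrite cQ bern_meanZ bern_mean_sum.
apply: (mulfI m1); rewrite mulVKf //; rewrite mulr_sumr.
apply: eq_bigr => l1 l1A; rewrite bern_mean_sum (bigD1 l1) //=.
rewrite [X in X + _](@bern_mean_eq _ _ _ _ _ (fun=> 0)); last first.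
  by move=> S _; rewrite andbN.
rewrite bern_mean_cst add0r.
rewrite (eq_bigr (fun=> p l1 * (1 - p l1))); last first.
  move=> l2 /andP[l2A l12]; rewrite bern_mean_mem_notin ?finset.in_setT //.
    by rewrite (homQ A AQ l2 l1).
  by rewrite eq_sym.
rewrite sumr_const (eq_card (B := A :\ l1)); last first.
  by move=> l2; rewrite !inE andbC.
by rewrite -[_ *+ _]mulr_natl (cardsD1 l1 A) l1A natrD addrAC subrr add0r.
Qed.

(** * Empirical quantiles *)

Definition sublevel (R : realDomainType) (I : finType) (x : I -> R) (y : R)
    : {set I} := [set i | x i <= y]%SET.

Lemma sublevel_subset (R : realDomainType) (I : finType) (x : I -> R) (y z : R) :
  y <= z -> sublevel x y \subset sublevel x z.
Proof.
move=> yz; apply/fintype.subsetP => i; rewrite !finset.inE => xy.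
exact: le_trans yz.
Qed.

Lemma empirical_dfE (R : realType) (n : nat) (x : 'I_n -> R) (y : R) :
  empirical_df x y = n%:R^-1 * #|sublevel x y|%:R.
Proof.
rewrite /empirical_df -(finset.setTI (sublevel x y)) -sum_mem_card.
congr (_ * _); apply: eq_big => i; first by rewrite finset.in_setT.
by rewrite finset.inE.
Qed.

(** The Galois connection between a right-continuous distribution function and
    its quantile function.  Here it holds because the least observation whose
    empirical distribution value reaches tau is the least such real number. *)
Lemma empirical_quantile_le (R : realType) (n : nat) (x : 'I_n -> R)
    (tau y : R) : (0 < n)%N -> 0 < tau < 1 ->
  (quantile (empirical_df x) tau <= y) = (tau <= empirical_df x y).
Proof.
move=> n0 /andP[t0 t1].
have mono a b : a <= b -> empirical_df x a <= empirical_df x b.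
  move=> ab; rewrite !empirical_dfE ler_wpM2l ?invr_ge0 ?ler0n // ler_nat.
  by apply: subset_leq_card; exact: sublevel_subset.
pose i0 : 'I_n := Ordinal n0.
have [i1 _ xi1] := arg_maxP x (erefl : xpredT i0).
have top : tau <= empirical_df x (x i1).
  rewrite empirical_dfE (_ : sublevel _ _ = [set: 'I_n]%SET).
    by rewrite cardsT card_ord mulVf ?pnatr_eq0 -?lt0n // ltW.
  by apply/setP => i; rewrite !finset.inE; exact: xi1.
have [j jtau jmin] := arg_minP (P := fun i => tau <= empirical_df x (x i)) x top.
(* the set defining the quantile has a least element, an observation *)
have least z : tau <= empirical_df x z -> x j <= z.
  move=> tz.
  have [k kz] : exists k, x k <= z.
    have : (0 < #|sublevel x z|)%N.
      rewrite lt0n; apply: contraTneq tz => c0.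
      by rewrite empirical_dfE c0 mulr0 -ltNge.
    by move=> /card_gt0P[k]; rewrite finset.inE; exists k.
  have [l lz lmax] := arg_maxP (P := fun i => x i <= z) x kz.
  apply: le_trans lz; apply: jmin; apply: (le_trans tz).
  rewrite !empirical_dfE ler_wpM2l ?invr_ge0 ?ler0n // ler_nat.
  apply: subset_leq_card; apply/fintype.subsetP => i; rewrite !finset.inE.
  exact: lmax.
have -> : quantile (empirical_df x) tau = x j.
  apply/eqP; rewrite eq_le; apply/andP; split.
    apply: ge_inf; last exact: jtau.
    by exists (x j) => z /=; exact: least.
  by apply: lb_le_inf; [exists (x j); exact: jtau|move=> z /=; exact: least].
by apply/idP/idP => [xy|]; [exact: le_trans jtau (mono _ _ xy)|exact: least].
Qed.

Lemma variance_estimatorE (R : realType) (n : nat) (Q : {set {set 'I_n}})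
    (x : 'I_n -> R) (tau : R) :
  variance_estimator Q x tau =
  n%:R^-1 * block_stat R Q (sublevel x (quantile (empirical_df x) tau)).
Proof.
rewrite /variance_estimator /block_stat; congr (_ * _).
apply: eq_bigr => A _; congr (_ * _).
apply: eq_bigr => l1 _; apply: eq_bigr => l2 _.
by rewrite !finset.inE -ltNge.
Qed.

(** * Quantiles of the average distribution function *)

(** The set defining the quantile is closed, hence contains its infimum, which
    gives one inequality; the other holds as the value p is attained. *)
Lemma continuous_quantileK (R : realType) (G : R -> R) (p : R) :
  continuous G -> {homo G : x y / x <= y} ->
  (exists x, G x < p) -> (exists x, G x = p) ->
  G (quantile G p) = p.
Proof.
move=> cG mono [a Ga] [b Gb].
have lb : has_lbound [set x | p <= G x].
  exists a => z /= pz; rewrite leNgt; apply/negP => za.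
  by have := lt_le_trans Ga (le_trans pz (mono _ _ (ltW za))); rewrite ltxx.
have ne : [set x | p <= G x] !=set0 by exists b; rewrite /= Gb.
apply/eqP; rewrite eq_le; apply/andP; split.
  by rewrite -{2}Gb; apply: mono; apply: ge_inf => //=; rewrite Gb.
have cl : closed [set x | p <= G x].
  have := (continuous_closedP G).1 cG [set y | p <= y].
  by apply; exact: closed_ge.
apply: (itv_closed_infimums ne cl); split.
  by apply: ge_inf.
by move=> z lz; apply: lb_le_inf.
Qed.

Lemma average_dfM (R : realType) (n : nat) (F : 'I_n -> R -> R) (x : R) :
  (0 < n)%N -> n%:R * average_df F x = \sum_(i < n) F i x.
Proof. by move=> n0; rewrite /average_df mulVKf // pnatr_eq0 -lt0n. Qed.

Lemma df_ge0_le1 d (T : measurableType d) (R : realType) (P : probability T R)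
    (X : {RV P >-> R}) (F : R -> R) : (forall x, cdf X x = (F x)%:E) ->
  forall x, 0 <= F x <= 1.
Proof. by move=> XF x; rewrite -!lee_fin -XF cdf_ge0 cdf_le1. Qed.

Lemma df_homo d (T : measurableType d) (R : realType) (P : probability T R)
    (X : {RV P >-> R}) (F : R -> R) : (forall x, cdf X x = (F x)%:E) ->
  {homo F : x y / x <= y}.
Proof. by move=> XF x y xy; rewrite -lee_fin -!XF; exact: cdf_nondecreasing. Qed.

Lemma average_df_homo (R : realType) (n : nat) (F : 'I_n -> R -> R) :
  (forall i, {homo F i : x y / x <= y}) ->
  {homo average_df F : x y / x <= y}.
Proof.
move=> Fh x y xy; rewrite /average_df ler_wpM2l ?invr_ge0 ?ler0n //.
by apply: ler_sum => i _; exact: Fh.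
Qed.

Lemma average_df_cvg (R : realType) (n : nat) (F : 'I_n -> R -> R)
    (G : set_system R) (l : R) : Filter G -> (0 < n)%N ->
  (forall i, F i x @[x --> G] --> l) -> average_df F x @[x --> G] --> l.
Proof.
move=> FG n0 Fl.
have -> : l = n%:R^-1 * \sum_(i < n) l.
  by rewrite sumr_const card_ord -[l *+ n]mulr_natl mulKf // pnatr_eq0 -lt0n.
apply: cvgM; first exact: cvg_cst.
by apply: cvg_big => //; exact: add_continuous.
Qed.

(** The average inherits the limits 0 and 1 at infinity, and the intermediate
    value theorem applies. *)
Lemma average_df_surj d (T : measurableType d) (R : realType)
    (P : probability T R) (n : nat) (X : 'I_n -> {RV P >-> R})
    (F : 'I_n -> R -> R) : (0 < n)%N ->
  (forall i x, cdf (X i) x = (F i x)%:E) -> continuous (average_df F) ->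
  forall p, 0 < p < 1 ->
  (exists x, average_df F x < p) /\ (exists x, average_df F x = p).
Proof.
move=> n0 XF cF p /andP[p0 p1].
have mono : {homo average_df F : x y / x <= y}.
  by apply: average_df_homo => i; exact: df_homo (XF i).
have cdfE i : cdf (X i) = EFin \o F i by apply/funext => x; rewrite XF.
have c0 : average_df F x @[x --> -oo] --> (0 : R).
  apply: average_df_cvg => // i.
  by have := cvg_cdfNy0 (X i); rewrite cdfE => /fine_cvg.
have c1 : average_df F x @[x --> +oo] --> (1 : R).
  apply: average_df_cvg => // i.
  by have := cvg_cdfy1 (X i); rewrite cdfE => /fine_cvg.
have [a Ga] : exists a, average_df F a < p.
  have : \forall x \near -oo, average_df F x < p by exact: cvgr_lt c0 _ p0.
  move=> /(@filter_ex _ _ _) [] a; by exists a.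
have [b Gb] : exists b, p < average_df F b.
  have : \forall x \near +oo, p < average_df F x by exact: cvgr_gt c1 _ p1.
  move=> /(@filter_ex _ _ _) [] b; by exists b.
split; first by exists a.
have ab : a <= b.
  rewrite leNgt; apply/negP => /ltW /mono; rewrite leNgt => /negP; apply.
  exact: lt_trans Gb.
have [||c _ <-] := @IVT _ (average_df F) a b p ab; last by exists c.
  by apply: continuous_subspaceT.
by rewrite ge_min le_max (ltW Ga) (ltW Gb) orbT.
Qed.

(** * The law of the observations below a threshold *)

(** The threshold may be random: this covers both the fixed levels and the
    empirical quantile. *)
Lemma measurable_sublevel_event d (T : measurableType d) (R : realType)
    (I : finType) (X : I -> T -> R) (t : T -> R) (Q : {set I} -> Prop) :
  (forall i, measurable_fun setT (X i)) -> measurable_fun setT t ->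
  measurable [set w | Q (sublevel (X^~ w) (t w))].
Proof.
move=> mX mt.
rewrite (_ : [set w | _] = \bigcup_(S in [set S : {set I} | Q S])
   \bigcap_(i in [set: I]) [set w | (X i w <= t w) = (i \in S)]); last first.
  apply/seteqP; split => [w Qw|w [S QS] Sw].
    exists (sublevel (X^~ w) (t w)) => //= i _ /=.
    by rewrite finset.inE.
  rewrite /= (_ : sublevel _ _ = S) //.
  by apply/setP => i; rewrite finset.inE; exact: Sw.
apply: fin_bigcup_measurable => // S _.
apply: fin_bigcap_measurable => // i _.
have := measurable_fun_ler (mX i) mt measurableT (Y := [set i \in S]).
by rewrite setTI; apply.
Qed.

Lemma measurable_empirical_quantile d (T : measurableType d) (R : realType)
    (n : nat) (X : 'I_n -> T -> R) (tau : R) : (0 < n)%N -> 0 < tau < 1 ->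
  (forall i, measurable_fun setT (X i)) ->
  measurable_fun setT (fun w => quantile (empirical_df (X^~ w)) tau).
Proof.
move=> n0 tau01 mX mD; apply: (measurability _ (RGenOInfty.measurableE R)) => //.
move=> /= _ [_ [y ->] <-]; apply: measurableI => //.
rewrite (_ : _ @^-1` _ =
  [set w | ~~ (tau <= n%:R^-1 * #|sublevel (X^~ w) (cst y w)|%:R)]).
  by apply: (measurable_sublevel_event (fun S : {set 'I_n} =>
    ~~ (tau <= n%:R^-1 * #|S|%:R))).
apply/seteqP; split => w /=;
  by rewrite in_itv /= andbT -empirical_dfE -empirical_quantile_le // -ltNge.
Qed.

(** Independence applied to the half-lines up to y and their complements, one
    choice for each set S, then summed over the finitely many S. *)
Lemma sublevel_law d (T : measurableType d) (R : realType)
    (P : probability T R) (n : nat) (X : 'I_n -> {RV P >-> R})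
    (F : 'I_n -> R -> R) (y : R) (Q : pred {set 'I_n}) :
  independent_RVs X -> (forall i x, cdf (X i) x = (F i x)%:E) ->
  P [set w | Q (sublevel (fun i => X i w) y)] =
  (\sum_(S | Q S) bern_weight (F^~ y) [set: 'I_n]%SET S)%:E.
Proof.
move=> indep XF.
have mX i : measurable_fun setT (X i) by [].
pose E (S : {set 'I_n}) := [set w | sublevel (fun i => X i w) y = S].
have PE S : P (E S) = (bern_weight (F^~ y) [set: 'I_n]%SET S)%:E.
  pose B i := if i \in S then `]-oo, y]%classic else ~` `]-oo, y]%classic.
  have mB i : measurable (B i).
    by rewrite /B; case: ifP => _; [|apply: measurableC]; exact: measurable_itv.
  have := indep [set: 'I_n]%SET B (fun i _ => mB i).
  rewrite (_ : [set w | _] = E S); last first.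
    apply/seteqP; split => w.
      move=> Bw; apply/setP => i; rewrite finset.inE.
      have := Bw i (finset.in_setT i); rewrite /B.
      case: (i \in S); first by rewrite /= in_itv.
      by move/negP; rewrite in_itv /= => /negbTE.
    move=> Sw i _; rewrite /B -Sw finset.inE.
    case: ifPn; first by rewrite /= in_itv.
    by move=> /negP + /=; rewrite in_itv.
  move=> ->; rewrite /bern_weight -prodEFin; apply: eq_bigr => i _.
  rewrite /B; case: (i \in S); first by rewrite -XF.
  rewrite preimage_setC probability_setC; first by rewrite EFinB -XF.
  by have := mX i measurableT `]-oo, y]%classic (measurable_itv _); rewrite setTI.
rewrite (_ : [set w | _] = \bigcup_(S in [set` Q]) E S); last first.
  apply/seteqP; split => [w Qw|w [S QS Sw]] /=; last by rewrite Sw.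
  by exists (sublevel (fun i => X i w) y).
rewrite measure_fin_bigcup //; last 2 first.
- by move=> S S' _ _ [w [Sw S'w]]; rewrite -Sw -S'w.
- move=> S _.
  by apply: (measurable_sublevel_event (fun S' : {set 'I_n} => S' = S)
    (t := cst y)).
rewrite -(bigfs _ (index_enum_uniq {set 'I_n})); last first.
  by move=> S _; rewrite mem_index_enum.
by rewrite -sumEFin; apply: eq_bigr => S _; exact: PE.
Qed.

Lemma sublevel_chebyshev d (T : measurableType d) (R : realType)
    (P : probability T R) (n : nat) (X : 'I_n -> {RV P >-> R})
    (F : 'I_n -> R -> R) (y c : R) (f : {set 'I_n} -> R) :
  independent_RVs X -> (forall i x, cdf (X i) x = (F i x)%:E) ->
  (forall i (S : {set 'I_n}), i \notin S -> `|f (i |: S) - f S| <= 1) ->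
  0 < c ->
  (P [set w | (c <= `|f (sublevel (fun i => X i w) y) -
                      bern_mean (F^~ y) [set: 'I_n]%SET f|)%R] <=
   ((\sum_i F i y * (1 - F i y)) / c ^+ 2)%R%:E)%E.
Proof.
move=> indep XF f1 c0.
have F01 i : 0 <= F i y <= 1 by exact: df_ge0_le1 (XF i) y.
set m := bern_mean _ _ f.
rewrite (sublevel_law y (fun S => c <= `|f S - m|) indep XF) lee_fin.
rewrite ler_pdivlMr ?exprn_gt0 //.
have var : bern_mean (F^~ y) [set: 'I_n]%SET (fun S => (f S - m) ^+ 2) <=
    \sum_i F i y * (1 - F i y).
  have := bern_var_lipschitz [set: 'I_n]%SET F01 f1; rewrite -/m.
  rewrite [leRHS](eq_bigl xpredT); last by move=> i; rewrite finset.in_setT.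
  apply: le_trans; rewrite le_eqVlt; apply/orP; left; apply/eqP.
  rewrite (@bern_mean_eq _ _ _ _ _ (fun S => f S ^+ 2 - (2 * m * f S - m ^+ 2))).
    by rewrite !bern_meanB bern_meanZ bern_mean_cst -/m; ring.
  by move=> S _; ring.
apply: le_trans var.
rewrite /bern_mean mulr_suml [leLHS]big_mkcond [leRHS](eq_bigl xpredT); last first.
  by move=> S; rewrite finset.subsetT.
apply: ler_sum => S _; have w0 := bern_weight_ge0 [set: 'I_n]%SET S F01.
case: ifPn => [cS|_]; last by rewrite mulr_ge0 // sqr_ge0.
rewrite ler_wpM2l // -[leRHS]real_normK ?num_real // lerXn2r ?nnegrE //.
exact: ltW.
Qed.

(** * Consistency of the variance estimator *)

Lemma card_setU1_lipschitz (R : numDomainType) (I : finType) (i : I)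
    (S : {set I}) : i \notin S -> `|#|i |: S|%:R - #|S|%:R| <= 1 :> R.
Proof. by move=> iS; rewrite cardsU1 iS natrD addrK normr1. Qed.

(** The deterministic part of the argument, with e in the role of delta v.  If
    the empirical quantile Q is at most q, then #|S_Q| lies between n tau and
    #|S_q|; otherwise Q <= q' and #|S_Q| lies between #|S_q| and #|S_q'|.  In
    both cases #|S_Q| and #|S_q| differ by at most 3 e. *)
Lemma block_stat_quantile_near (R : realType) (n : nat)
    (Q : {set {set 'I_n}}) (x : 'I_n -> R) (tau q q' v e : R) :
  (0 < n)%N -> 0 < tau < 1 ->
  finset.partition Q [set: 'I_n]%SET ->
  (forall A, A \in Q -> (2 <= #|A|)%N) -> q <= q' ->
  `|block_stat R Q (sublevel x q) - v| < e ->
  `|#|sublevel x q|%:R - n%:R * tau| < e ->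
  `|#|sublevel x q'|%:R - (n%:R * tau + e)| < e ->
  `|block_stat R Q (sublevel x (quantile (empirical_df x) tau)) - v| <= 4 * e.
Proof.
move=> n0 tau01 partQ cardQ qq' hv hq hq'.
set qh := quantile _ _.
have nR0 : 0 < n%:R :> R by rewrite ltr0n.
have tauE y : (tau <= empirical_df x y) = (n%:R * tau <= #|sublevel x y|%:R).
  by rewrite empirical_dfE mulrC -ler_pdivrMr ?invr_gt0 // invrK mulrC.
have qhq' : qh <= q'.
  rewrite empirical_quantile_le // tauE.
  by move: hq'; rewrite ltr_norml => /andP[]; lra.
have nqh : n%:R * tau <= #|sublevel x qh|%:R by rewrite -tauE -empirical_quantile_le.
set h := block_stat R Q in hv *.
have gap : `|h (sublevel x qh) - h (sublevel x q)| <= 3 * e.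
  have e0 : 0 <= e := le_trans (normr_ge0 _) (ltW hv).
  have [qhq|/ltW qqh] := leP qh q.
    rewrite distrC.
    have := block_stat_lipschitz R partQ cardQ (sublevel_subset x qhq).
    move/le_trans; apply.
    by move: hq; rewrite ltr_norml => /andP[]; lra.
  have := block_stat_lipschitz R partQ cardQ (sublevel_subset x qqh).
  move/le_trans; apply.
  have : #|sublevel x qh|%:R <= #|sublevel x q'|%:R :> R.
    by rewrite ler_nat; apply: subset_leq_card; exact: sublevel_subset.
  by move: hq hq'; rewrite !ltr_norml => /andP[? ?] /andP[? ?]; lra.
move: gap hv; rewrite ler_norml ltr_norml ler_norml.
by move=> /andP[? ?] /andP[? ?]; apply/andP; split; lra.
Qed.

(** Chebyshev's inequality is applied three times with deviation e = delta v:
    to h(S_q) and #|S_q|, of variance at most v, and to #|S_q'|, of variance at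
    most v + e <= 2 v.  The total is 4 v / e^2 = 4 / (delta^2 v). *)
Lemma variance_ratio_deviation d (T : measurableType d) (R : realType)
    (P : probability T R) (n : nat) (X : 'I_n -> {RV P >-> R})
    (F : 'I_n -> R -> R) (Q : {set {set 'I_n}}) (tau delta eps : R) :
  (0 < n)%N -> 0 < tau < 1 -> 0 < delta < 1 -> 4 * delta <= eps ->
  independent_RVs X -> (forall i x, cdf (X i) x = (F i x)%:E) ->
  continuous (average_df F) -> finset.partition Q [set: 'I_n]%SET ->
  (forall A, A \in Q -> (2 <= #|A|)%N) ->
  (forall A, A \in Q -> {in A &, forall i j, F i = F j}) ->
  let v := n%:R * heterogeneous_variance F tau in
  0 < v ->
  (P [set w | (eps < `|variance_estimator Q (fun i => X i w) tau /
                       heterogeneous_variance F tau - 1|)%R] <=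
   (4 / delta ^+ 2 * v^-1)%R%:E)%E.
Proof.
move=> n0 tau01 /andP[d0 d1] deps indep XF cF partQ cardQ homQ v v0.
have /andP[t0 t1] := tau01.
have nR0 : 0 < n%:R :> R by rewrite ltr0n.
have nN0 : n%:R != 0 :> R by rewrite gt_eqF.
have F01 i y : 0 <= F i y <= 1 by exact: df_ge0_le1 (XF i) y.
have Fh i : {homo F i : x y / x <= y} by exact: df_homo (XF i).
have homo_av : {homo average_df F : x y / x <= y} by exact: average_df_homo.
have surj := average_df_surj n0 XF cF.
pose q := quantile (average_df F) tau.
have Gq : average_df F q = tau.
  by apply: continuous_quantileK => //; have [] := surj tau tau01.
have sumq : \sum_i F i q = n%:R * tau by rewrite -average_dfM // Gq.
have vE : v = \sum_i F i q * (1 - F i q).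
  by rewrite /v /heterogeneous_variance -/q mulrA mulfV // mul1r.
(* hence tau + delta v / n < 1, so that this level is attained *)
have v_le : v <= n%:R * (1 - tau).
  rewrite mulrBr mulr1 -sumq vE.
  have -> : n%:R - \sum_i F i q = \sum_i (1 - F i q).
    by rewrite sumrB sumr_const card_ord.
  apply: ler_sum => i _; have /andP[F0 F1] := F01 i q.
  by rewrite ler_piMl // subr_ge0.
pose e := delta * v.
have e0 : 0 < e by rewrite mulr_gt0.
have ev : e < v by rewrite /e gtr_pMl.
(* a level above q that the empirical quantile is unlikely to exceed *)
have [q' Gq'] : exists x, average_df F x = tau + e / n%:R.
  have en0 : 0 < e / n%:R by rewrite divr_gt0.
  have en1 : e / n%:R < 1 - tau by rewrite ltr_pdivrMr // mulrC; lra.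
  by apply: (surj _ _).2; apply/andP; split; lra.
have sumq' : \sum_i F i q' = n%:R * tau + e.
  by rewrite -average_dfM // Gq' mulrDr mulrCA mulfV // mulr1.
have qq' : q <= q'.
  rewrite leNgt; apply/negP => /ltW /homo_av; rewrite Gq Gq'.
  have : 0 < e / n%:R by rewrite divr_gt0.
  lra.
(* moving the threshold changes each a(1 - a) by at most the change of a *)
have vq' : \sum_i F i q' * (1 - F i q') <= 2 * v.
  have : \sum_i F i q' * (1 - F i q') <=
      \sum_i (F i q * (1 - F i q) + (F i q' - F i q)).
    apply: ler_sum => i _; have := Fh i _ _ qq'.
    have /andP[] := F01 i q; have /andP[] := F01 i q'.
    move: (F i q) (F i q') => a b b0 b1 a0 a1 ab.
    have : 0 <= (b - a) * (a + b) by rewrite mulr_ge0 // ?subr_ge0 // addr_ge0.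
    nra.
  rewrite big_split /= -vE sumrB sumq sumq' => /le_trans; apply.
  lra.
pose S y w := sublevel (fun i => X i w) y.
pose h := block_stat R Q.
pose B1 := [set w | e <= `|h (S q w) - v|].
pose B2 := [set w | e <= `|#|S q w|%:R - n%:R * tau|].
pose B3 := [set w | e <= `|#|S q' w|%:R - (n%:R * tau + e)|].
have mX i : measurable_fun setT (X i) by [].
have mean_h : bern_mean (F^~ q) [set: 'I_n]%SET h = v.
  rewrite vE; apply: bern_mean_block_stat => // A AQ i j iA jA.
  by rewrite (homQ A AQ i j).
have PB1 : (P B1 <= (v / e ^+ 2)%:E)%E.
  have := sublevel_chebyshev q (f := h) indep XF _ e0.
  rewrite mean_h -vE; apply => i U iU.
  have := block_stat_lipschitz R partQ cardQ (finset.subsetUr [set i]%SET U).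
  by move/le_trans; apply; rewrite cardsU1 iU natrD addrK.
have PB2 : (P B2 <= (v / e ^+ 2)%:E)%E.
  have := sublevel_chebyshev q (f := fun U => #|U|%:R) indep XF
    (@card_setU1_lipschitz R _) e0.
  by rewrite bern_mean_card sumq -vE.
have PB3 : (P B3 <= (2 * v / e ^+ 2)%:E)%E.
  have := sublevel_chebyshev q' (f := fun U => #|U|%:R) indep XF
    (@card_setU1_lipschitz R _) e0.
  rewrite bern_mean_card sumq' => /le_trans; apply.
  by rewrite lee_fin ler_pM2r // invr_gt0 exprn_gt0.
set E := [set w | _].
have HV0 : heterogeneous_variance F tau = v / n%:R.
  by rewrite /v mulrC mulKf.
have EE : E = [set w | eps <
    `|h (S (quantile (empirical_df (fun i => X i w)) tau) w) / v - 1|].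
  rewrite /E; apply/seteqP; split => w /=; rewrite variance_estimatorE HV0 -/h -/(S _ w);
    by rewrite invf_div mulrACA mulVf // mul1r.
have mS y (D : {set 'I_n} -> Prop) : measurable [set w | D (S y w)].
  exact: (measurable_sublevel_event D mX (measurable_cst y)).
have mB1 : measurable B1 by exact: (mS q (fun U => e <= `|h U - v|)).
have mB2 : measurable B2 by exact: (mS q (fun U => e <= `|#|U|%:R - n%:R * tau|)).
have mB3 : measurable B3.
  exact: (mS q' (fun U => e <= `|#|U|%:R - (n%:R * tau + e)|)).
have mE : measurable E.
  rewrite EE; exact: (measurable_sublevel_event (fun U => eps < `|h U / v - 1|)
    mX (measurable_empirical_quantile n0 tau01 mX)).
have EB : E `<=` B1 `|` B2 `|` B3.
  rewrite EE => w /= Ew; apply: contrapT => /not_orP[/not_orP[]].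
  rewrite /B1 /B2 /B3 /= => /negP; rewrite -ltNge => b1 /negP; rewrite -ltNge => b2.
  move=> /negP; rewrite -ltNge => b3.
  have := block_stat_quantile_near n0 tau01 partQ cardQ qq' b1 b2 b3.
  rewrite leNgt => /negP; apply.
  move: Ew; rewrite /S -/h; set z := h _ => Ew.
  have -> : z - v = (z / v - 1) * v by rewrite mulrBl mul1r divfK // gt_eqF.
  rewrite normrM (gtr0_norm v0) /e mulrA ltr_pM2r //.
  exact: le_lt_trans Ew.
apply: (@le_trans _ _ (P (B1 `|` B2 `|` B3))).
  by apply: le_measure; rewrite ?inE //; apply: measurableU => //;
     apply: measurableU.
apply: (@le_trans _ _ (P B1 + P B2 + P B3)%E).
  apply: (le_trans (measureU2 P (measurableU _ _ mB1 mB2) mB3)).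
  by rewrite leeD2r // measureU2.
apply: (le_trans (leeD (leeD PB1 PB2) PB3)).
rewrite -!EFinD lee_fin le_eqVlt; apply/orP; left; apply/eqP.
by rewrite /e; field; rewrite !gt_eqF.
Qed.

Theorem proposition1 (R : realType) (d : nat -> measure_display)
    (T : forall n : nat, measurableType (d n))
    (P : forall n : nat, probability (T n) R)
    (X : forall n : nat, 'I_n -> {RV (P n) >-> R})
    (F : forall n : nat, 'I_n -> R -> R)
    (Pi : forall n : nat, {set {set 'I_n}})
    (indepX : forall n : nat, (2 <= n)%N -> independent_RVs (X n))
    (cdfX : forall n : nat, (2 <= n)%N ->
      forall (i : 'I_n) (x : R), cdf (X n i) x = (F n i x)%:E)
    (contF : forall n : nat, (2 <= n)%N -> continuous (average_df (F n)))
    (partPi : forall n : nat, (2 <= n)%N ->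
      finset.partition (Pi n) [set: 'I_n]%SET)
    (cardPi : forall n : nat, (2 <= n)%N ->
      forall A : {set 'I_n}, A \in Pi n -> (2 <= #|A|)%N)
    (homPi : forall n : nat, (2 <= n)%N ->
      forall A : {set 'I_n}, A \in Pi n ->
      forall i j : 'I_n, i \in A -> j \in A -> F n i = F n j)
    (tau : R) (tau01 : 0 < tau < 1) :
  n%:R * heterogeneous_variance (F n) tau @[n --> \oo] --> +oo ->
  cvg_in_probability P
    (fun (n : nat) (w : T n) =>
       variance_estimator (Pi n) (fun i : 'I_n => X n i w) tau /
       heterogeneous_variance (F n) tau)
    1.
Proof.
set v := fun n => n%:R * heterogeneous_variance (F n) tau.
move=> vy eps eps0.
pose delta := Num.min (eps / 4) (1 / 2).
have d0 : 0 < delta by rewrite lt_min !divr_gt0.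
have d1 : delta < 1 by rewrite gt_min; apply/orP; right; lra.
have deps : 4 * delta <= eps.
  have : delta <= eps / 4 by rewrite ge_min lexx.
  lra.
have v0 : \forall n \near \oo, 0 < v n by exact: cvgry_gt vy 0.
apply: (@squeeze_cvge _ _ _ _ (cst 0%E) _
  (fun n => (4 / delta ^+ 2 * (v n)^-1)%:E)).
- near=> n; rewrite measure_ge0 /=.
  have n2 : (2 <= n)%N by near: n; exact: nbhs_infty_ge.
  have n0 : (0 < n)%N by exact: leq_trans n2.
  apply: variance_ratio_deviation => //.
  + by rewrite d0.
  + exact: indepX.
  + exact: cdfX.
  + exact: contF.
  + exact: partPi.
  + exact: cardPi.
  + exact: homPi.
  + by near: n.
- exact: cvg_cst.
- apply: cvg_EFin; first by apply: nearW => n.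
  rewrite -[0](mulr0 (4 / delta ^+ 2)); apply: cvgM; first exact: cvg_cst.
  exact/gtr0_cvgV0.
Unshelve. all: by end_near. Qed.
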